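(* In the category $\mathsf{SRng}$ of semirings, the full subcategory of strongly unital objects is the category $\mathsf{Rng}$ of rings. In other words, a semiring $X$ is a ring if and only if the point $$(\pi_1\colon X\times X\to X,\quad \Delta_X=\langle 1_X,1_X\rangle\colon X\to X\times X)$$ is stably strong in $\mathsf{SRng}$.
   Context: A semiring is a set with a commutative monoid structure $(X,+,0)$ and an associative multiplication that distributes over $+$ on both sides and for which $0$ is absorbing ($0x=x0=0$); no multiplicative unit is required, and morphisms preserve $+$, $0$ and multiplication, so $\mathsf{SRng}$ is a pointed category. A ring is a semiring whose additive monoid is a group. In a finitely complete category, a pair of morphisms with common codomain $A$ is jointly strongly epimorphic if every monomorphism into $A$ through which both factor is an isomorphism. A point over $B$ is a pair $(f\colon A\to B,\ s\colon B\to A)$ with $fs=1_B$. Given $g\colon C\to B$, form the pullback $C\times_BA$ of $f$ along $g$, with projections $\pi_C,\pi_A$; the pullback of $(f,s)$ along $g$ is the point $(\pi_C,\langle 1_C,sg\rangle)$. The point $(f,s)$ is strong if for every $g\colon C\to B$ the pair $(\pi_A,s)$ is jointly strongly epimorphic (in a pointed category, equivalently, the pair $(\ker(f),s)$ is jointly strongly epimorphic). It is stably strong if its pullback along every morphism with codomain $B$ is strong. An object $Y$ of a pointed finitely complete category is strongly unital if the point $(\pi_1\colon Y\times Y\to Y,\ \Delta_Y)$ is stably strong. *)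

(* Defs.v *)
From HB Require Import structures.
From mathcomp Require Import all_boot ssralg.
From mathcomp Require Import boolp.
Set Implicit Arguments.
Unset Strict Implicit.
Unset Printing Implicit Defensive.
Import GRing.Theory.
Local Open Scope ring_scope.

Record category := Category {
  obj :> Type;
  hom : obj -> obj -> Type;
  idm : forall A, hom A A;
  ccomp : forall A B C, hom B C -> hom A B -> hom A C;
  comp_idl : forall A B (f : hom A B), ccomp (idm B) f = f;
  comp_idr : forall A B (f : hom A B), ccomp f (idm A) = f;
  comp_assoc : forall A B C D (f : hom C D) (g : hom B C) (h : hom A B),
    ccomp f (ccomp g h) = ccomp (ccomp f g) h }.

Arguments hom {c} A B.
Arguments idm {c} A.

Declare Scope cat_scope.
Delimit Scope cat_scope with cat.
Local Open Scope cat_scope.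
Notation "A --> B" := (hom A B) (at level 99, B at level 200) : cat_scope.
Notation "f \c g" := (ccomp f g) (at level 40, left associativity) : cat_scope.

Section CategoryNotions.
Variable C : category.

Definition mono (A B : C) (m : A --> B) : Prop :=
  forall (Z : C) (u v : Z --> A), m \c u = m \c v -> u = v.

Definition iso (A B : C) (f : A --> B) : Prop :=
  exists g : B --> A, g \c f = idm A /\ f \c g = idm B.

Definition factors_through (A M Z : C) (m : M --> A) (u : Z --> A) : Prop :=
  exists u' : Z --> M, m \c u' = u.

Definition jointly_strongly_epi (A Z W : C) (u : Z --> A) (v : W --> A) : Prop :=
  forall (M : C) (m : M --> A),
    mono m -> factors_through m u -> factors_through m v -> iso m.

Definition full_subcategory (P : C -> Prop) : category :=
  @Category {X : C | P X} (fun X Y => sval X --> sval Y)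
    (fun X => idm (sval X)) (fun X Y Z f g => f \c g)
    (fun X Y f => comp_idl f) (fun X Y f => comp_idr f)
    (fun X Y Z T f g h => comp_assoc f g h).

Record terminal := Terminal {
  term_obj :> C;
  term_mor : forall A, A --> term_obj;
  term_uniq : forall A (f g : A --> term_obj), f = g }.

Record product (A B : C) := Product {
  prod_obj :> C;
  prod_fst : prod_obj --> A;
  prod_snd : prod_obj --> B;
  prod_pair : forall Q, (Q --> A) -> (Q --> B) -> (Q --> prod_obj);
  prod_pair1 : forall Q (a : Q --> A) (b : Q --> B), prod_fst \c prod_pair a b = a;
  prod_pair2 : forall Q (a : Q --> A) (b : Q --> B), prod_snd \c prod_pair a b = b;
  prod_uniq : forall Q (h k : Q --> prod_obj),
    prod_fst \c h = prod_fst \c k -> prod_snd \c h = prod_snd \c k -> h = k }.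

Record pullback (A B D : C) (f : A --> D) (g : B --> D) := Pullback {
  pb_obj :> C;
  pb1 : pb_obj --> A;
  pb2 : pb_obj --> B;
  pb_comm : f \c pb1 = g \c pb2;
  pb_pair : forall Q (a : Q --> A) (b : Q --> B),
    f \c a = g \c b -> (Q --> pb_obj);
  pb_pair1 : forall Q (a : Q --> A) (b : Q --> B) (e : f \c a = g \c b),
    pb1 \c pb_pair e = a;
  pb_pair2 : forall Q (a : Q --> A) (b : Q --> B) (e : f \c a = g \c b),
    pb2 \c pb_pair e = b;
  pb_uniq : forall Q (h k : Q --> pb_obj),
    pb1 \c h = pb1 \c k -> pb2 \c h = pb2 \c k -> h = k }.

End CategoryNotions.

(** Pointed finitely complete categories, with chosen limits; being pointed
    means that the terminal object is initial.  Binary products are derivable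
    from pullbacks and the terminal object, but are chosen separately so that
    [X × X] can be the usual one in examples. *)
Record pointedLexCategory := PointedLexCategory {
  lex_cat :> category;
  zero_obj : terminal lex_cat;
  prods : forall A B : lex_cat, product A B;
  pullbacks : forall (A B D : lex_cat) (f : A --> D) (g : B --> D), pullback f g;
  zero_initial : forall A : lex_cat,
    exists f : (zero_obj : lex_cat) --> A,
      forall g : (zero_obj : lex_cat) --> A, g = f }.

Section Points.
Variable C : pointedLexCategory.

Record point (B : C) := Point {
  pt_obj : C;
  pt_proj : pt_obj --> B;
  pt_sect : B --> pt_obj;
  pt_splitting : pt_proj \c pt_sect = idm B }.

Section PullbackPoint.
Variables (B D : C) (g : D --> B) (p : point B).

(** The pullback [D ×_B A], with [pb1 : D ×_B A --> D] and
    [pb2 : D ×_B A --> A]. *)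
Definition pt_pullback := pullbacks g (pt_proj p).

Lemma pullback_point_comm : g \c idm D = pt_proj p \c (pt_sect p \c g).
Proof. by rewrite comp_assoc pt_splitting comp_idl comp_idr. Qed.

Definition pullback_point : point D :=
  @Point D pt_pullback (pb1 pt_pullback)
    (pb_pair pt_pullback pullback_point_comm)
    (pb_pair1 pt_pullback pullback_point_comm).

End PullbackPoint.

Definition strong (B : C) (p : point B) : Prop :=
  forall (D : C) (g : D --> B),
    jointly_strongly_epi (pb2 (pt_pullback g p)) (pt_sect p).

Definition stably_strong (B : C) (p : point B) : Prop :=
  forall (D : C) (g : D --> B), strong (pullback_point g p).

Definition diagonal_point (Y : C) : point Y :=
  @Point Y (prods Y Y) (prod_fst (prods Y Y))
    (prod_pair (prods Y Y) (idm Y) (idm Y))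
    (prod_pair1 (prods Y Y) (idm Y) (idm Y)).

Definition strongly_unital (Y : C) : Prop := stably_strong (diagonal_point Y).

End Points.

(** Semirings without multiplicative unit.  The library's [pzSemiRingType] is
    unital, so the structure joins a commutative monoid [(+%R, 0%R)] and a
    semigroup [*%g].  Carriers are [choiceType]s; this loses no generality, since
    [boolp] gives every type such a structure and morphisms ignore it. *)
HB.mixin Record Nmodule_Semigroup_isSemirng R
    of GRing.Nmodule R & Semigroup R := {
  srng_mulDl : left_distributive (@mul R) +%R;
  srng_mulDr : right_distributive (@mul R) +%R;
  srng_mul0r : left_zero (0 : R) (@mul R);
  srng_mulr0 : right_zero (0 : R) (@mul R) }.

#[short(type="semirngType")]
HB.structure Definition Semirng :=
  {R of Nmodule_Semigroup_isSemirng R & GRing.Nmodule R & Semigroup R}.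

Definition is_ring (R : semirngType) : Prop :=
  forall x : R, exists y : R, x + y = 0.

#[short(type="semirngMorphism")]
HB.structure Definition SemirngMorphism (R S : semirngType) :=
  {f of GRing.isNmodMorphism R S f & isMultiplicative R S f}.

Lemma semirng_morphism_eq (R S : semirngType) (f g : semirngMorphism R S) :
  f =1 g -> f = g.
Proof.
case: f g => [f [[f0D] [fM]]] [g [[g0D] [gM]]] /= /funext fg.
case: _ / fg g0D gM => g0D gM.
by rewrite (Prop_irrelevance f0D g0D) (Prop_irrelevance fM gM).
Qed.

HB.instance Definition _ (R : semirngType) :=
  Multiplicative.on (@idfun R).
HB.instance Definition _ (R S T : semirngType)
  (f : semirngMorphism S T) (g : semirngMorphism R S) :=
  Multiplicative.on (f \o g).

Fact srng_comp_idl (R S : semirngType) (f : semirngMorphism R S) :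
  (idfun \o f : semirngMorphism R S) = f.
Proof. exact: semirng_morphism_eq. Qed.
Fact srng_comp_idr (R S : semirngType) (f : semirngMorphism R S) :
  (f \o idfun : semirngMorphism R S) = f.
Proof. exact: semirng_morphism_eq. Qed.
Fact srng_compA (R S T U : semirngType) (f : semirngMorphism T U)
    (g : semirngMorphism S T) (h : semirngMorphism R S) :
  (f \o (g \o h) : semirngMorphism R U) = (f \o g) \o h.
Proof. exact: semirng_morphism_eq. Qed.

Definition SRng_cat : category :=
  @Category semirngType semirngMorphism (fun R => idfun) (fun R S T f g => f \o g)
    srng_comp_idl srng_comp_idr srng_compA.

Section ZeroSemirng.

Let add_unit (_ _ : unit) := tt.
Fact unit_addA : associative add_unit. Proof. by []. Qed.
Fact unit_addC : commutative add_unit. Proof. by []. Qed.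
Fact unit_add0 : left_id tt add_unit. Proof. by case. Qed.
HB.instance Definition _ := GRing.isNmodule.Build unit unit_addA unit_addC unit_add0.
HB.instance Definition _ := isSemigroup.Build unit unit_addA.
Fact unit_all_eq (x y : unit) : x = y. Proof. by case: x; case: y. Qed.
HB.instance Definition _ := Nmodule_Semigroup_isSemirng.Build unit
  (fun _ _ _ => erefl) (fun _ _ _ => erefl)
  (fun _ => erefl) (fun _ => erefl).
End ZeroSemirng.

Section ZeroMorphisms.
Variables R S : semirngType.

Definition srng_zero (_ : R) : S := 0.
Fact srng_zero_nmod_morphism : GRing.nmod_morphism srng_zero.
Proof. by split=> [|x y]; rewrite /srng_zero ?addr0. Qed.
Fact srng_zero_multiplicative : {morph srng_zero : x y / (x * y)%g}.
Proof. by move=> x y; rewrite /srng_zero srng_mul0r. Qed.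
HB.instance Definition _ :=
  GRing.isNmodMorphism.Build R S srng_zero srng_zero_nmod_morphism.
HB.instance Definition _ :=
  isMultiplicative.Build R S srng_zero srng_zero_multiplicative.

End ZeroMorphisms.

Definition SRng_zero : terminal SRng_cat.
Proof.
apply: (@Terminal SRng_cat (unit : semirngType) (fun R => @srng_zero R unit)).
by move=> R f g; apply: semirng_morphism_eq => x; apply: unit_all_eq.
Defined.

Fact SRng_zero_initial (R : SRng_cat) :
  exists f : hom (SRng_zero : SRng_cat) R,
    forall g : hom (SRng_zero : SRng_cat) R, g = f.
Proof.
exists (@srng_zero unit R : semirngMorphism unit R) => g; apply: semirng_morphism_eq => -[].
exact: (raddf0 (g : {additive unit -> R})).
Qed.

Section ProdSemirng.
Variables R S : semirngType.

Fact pair_srng_mulDl : left_distributive (@mul (R * S)%type) +%R.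
Proof. by move=> x y z; congr (_, _); apply: srng_mulDl. Qed.
Fact pair_srng_mulDr : right_distributive (@mul (R * S)%type) +%R.
Proof. by move=> x y z; congr (_, _); apply: srng_mulDr. Qed.
Fact pair_srng_mul0r : left_zero (0 : R * S) (@mul (R * S)%type).
Proof. by move=> x; congr (_, _); apply: srng_mul0r. Qed.
Fact pair_srng_mulr0 : right_zero (0 : R * S) (@mul (R * S)%type).
Proof. by move=> x; congr (_, _); apply: srng_mulr0. Qed.
HB.instance Definition _ := Nmodule_Semigroup_isSemirng.Build (R * S)%type
  pair_srng_mulDl pair_srng_mulDr pair_srng_mul0r pair_srng_mulr0.

HB.instance Definition _ := Multiplicative.on (@fst R S).
HB.instance Definition _ := Multiplicative.on (@snd R S).

Variables (Q : semirngType)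
  (a : semirngMorphism Q R) (b : semirngMorphism Q S).

Definition srng_pair (q : Q) : R * S := (a q, b q).
Fact srng_pair_nmod_morphism : GRing.nmod_morphism srng_pair.
Proof. by split=> [|x y]; rewrite /srng_pair ?raddf0 ?raddfD. Qed.
Fact srng_pair_multiplicative : {morph srng_pair : x y / (x * y)%g}.
Proof. by move=> x y; rewrite /srng_pair !gmulfM. Qed.
HB.instance Definition _ :=
  GRing.isNmodMorphism.Build Q (R * S)%type srng_pair srng_pair_nmod_morphism.
HB.instance Definition _ :=
  isMultiplicative.Build Q (R * S)%type srng_pair srng_pair_multiplicative.

End ProdSemirng.

Definition SRng_prod (R S : semirngType) : @product SRng_cat R S.
Proof.
apply: (@Product SRng_cat R S (R * S : semirngType)%type
  (@fst R S : semirngMorphism _ _) (@snd R S : semirngMorphism _ _)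
  (fun (Q : semirngType) a b =>
    (@srng_pair R S Q a b : semirngMorphism Q (R * S)%type))).
- by move=> Q a b; apply: semirng_morphism_eq.
- by move=> Q a b; apply: semirng_morphism_eq.
- move=> Q h k e1 e2; apply: semirng_morphism_eq => q.
  have /= E1 := congr1 (fun f : semirngMorphism _ _ => f q) e1.
  have /= E2 := congr1 (fun f : semirngMorphism _ _ => f q) e2.
  by apply/eqP; rewrite -pair_eqE /= E1 E2 !eqxx.
Defined.

Section PullbackSemirng.
Variables (R S T : semirngType).
Variables (f : semirngMorphism R T) (g : semirngMorphism S T).

Definition pb_pred : pred (R * S) := fun p => f p.1 == g p.2.

Record srng_pullback := SrngPullback {
  srng_pb_val :> R * S; _ : pb_pred srng_pb_val }.

HB.instance Definition _ := [isSub for srng_pb_val].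
HB.instance Definition _ := [Choice of srng_pullback by <:].

Fact pb_nmod_closed : GRing.nmod_closed pb_pred.
Proof.
split=> [|x y]; rewrite !unfold_in /pb_pred /= ?raddf0 ?eqxx //.
by move=> /eqP ex /eqP ey; rewrite !raddfD /= ex ey.
Qed.
Fact pb_mulg_closed : mulg_closed pb_pred.
Proof.
move=> x y; rewrite !unfold_in /pb_pred /=.
by move=> /eqP ex /eqP ey; rewrite !gmulfM /= ex ey.
Qed.
HB.instance Definition _ :=
  GRing.SubChoice_isSubNmodule.Build _ pb_pred srng_pullback pb_nmod_closed.
HB.instance Definition _ :=
  SubChoice_isSubSemigroup.Build _ pb_pred srng_pullback pb_mulg_closed.

Let valsD := @GRing.valD _ _ srng_pullback.
Let vals0 := @GRing.val0 _ _ srng_pullback.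
Let valsM := @valM _ _ srng_pullback.

Fact pb_srng_mulDl : left_distributive (@mul srng_pullback) +%R.
Proof. by move=> x y z; apply/val_inj; rewrite !(valsM, valsD) srng_mulDl. Qed.
Fact pb_srng_mulDr : right_distributive (@mul srng_pullback) +%R.
Proof. by move=> x y z; apply/val_inj; rewrite !(valsM, valsD) srng_mulDr. Qed.
Fact pb_srng_mul0r : left_zero (0 : srng_pullback) (@mul srng_pullback).
Proof. by move=> x; apply/val_inj; rewrite valsM vals0 srng_mul0r. Qed.
Fact pb_srng_mulr0 : right_zero (0 : srng_pullback) (@mul srng_pullback).
Proof. by move=> x; apply/val_inj; rewrite valsM vals0 srng_mulr0. Qed.
HB.instance Definition _ := Nmodule_Semigroup_isSemirng.Build srng_pullback
  pb_srng_mulDl pb_srng_mulDr pb_srng_mul0r pb_srng_mulr0.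

Definition srng_pb1 (p : srng_pullback) : R := (val p).1.
Fact srng_pb1_nmod_morphism : GRing.nmod_morphism srng_pb1.
Proof. by split=> [|x y]; rewrite /srng_pb1 ?vals0 ?valsD. Qed.
Fact srng_pb1_multiplicative : {morph srng_pb1 : x y / (x * y)%g}.
Proof. by move=> x y; rewrite /srng_pb1 valsM. Qed.
HB.instance Definition _ :=
  GRing.isNmodMorphism.Build srng_pullback R srng_pb1 srng_pb1_nmod_morphism.
HB.instance Definition _ :=
  isMultiplicative.Build srng_pullback R srng_pb1 srng_pb1_multiplicative.

Definition srng_pb2 (p : srng_pullback) : S := (val p).2.
Fact srng_pb2_nmod_morphism : GRing.nmod_morphism srng_pb2.
Proof. by split=> [|x y]; rewrite /srng_pb2 ?vals0 ?valsD. Qed.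
Fact srng_pb2_multiplicative : {morph srng_pb2 : x y / (x * y)%g}.
Proof. by move=> x y; rewrite /srng_pb2 valsM. Qed.
HB.instance Definition _ :=
  GRing.isNmodMorphism.Build srng_pullback S srng_pb2 srng_pb2_nmod_morphism.
HB.instance Definition _ :=
  isMultiplicative.Build srng_pullback S srng_pb2 srng_pb2_multiplicative.

Variables (Q : semirngType)
  (a : semirngMorphism Q R) (b : semirngMorphism Q S).
Hypothesis eab : (f \o a : semirngMorphism Q T) = g \o b.

Fact srng_pb_pair_subproof q : pb_pred (a q, b q).
Proof.
by apply/eqP; exact: (congr1 (fun h : semirngMorphism Q T => h q) eab).
Qed.
Definition srng_pb_pair (q : Q) : srng_pullback :=
  SrngPullback (srng_pb_pair_subproof q).
Fact srng_pb_pair_nmod_morphism : GRing.nmod_morphism srng_pb_pair.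
Proof.
split=> [|x y]; apply/val_inj.
  by rewrite vals0 /= !raddf0.
by rewrite valsD /= !raddfD.
Qed.
Fact srng_pb_pair_multiplicative : {morph srng_pb_pair : x y / (x * y)%g}.
Proof. by move=> x y; apply/val_inj; rewrite valsM /= !gmulfM. Qed.
HB.instance Definition _ :=
  GRing.isNmodMorphism.Build Q srng_pullback srng_pb_pair srng_pb_pair_nmod_morphism.
HB.instance Definition _ :=
  isMultiplicative.Build Q srng_pullback srng_pb_pair
    srng_pb_pair_multiplicative.

End PullbackSemirng.

Definition SRng_pullback (R S T : semirngType)
    (f : semirngMorphism R T) (g : semirngMorphism S T) :
  @pullback SRng_cat R S T f g.
Proof.
apply: (@Pullback SRng_cat R S T f g (srng_pullback f g : semirngType)
  (@srng_pb1 R S T f g : semirngMorphism _ _)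
  (@srng_pb2 R S T f g : semirngMorphism _ _) _
  (fun (Q : semirngType) a b e =>
    (@srng_pb_pair R S T f g Q a b e : semirngMorphism Q _))).
- by apply: semirng_morphism_eq => p; exact: (eqP (valP p)).
- by move=> Q a b e; apply: semirng_morphism_eq.
- by move=> Q a b e; apply: semirng_morphism_eq.
- move=> Q h k e1 e2; apply: semirng_morphism_eq => q; apply/val_inj.
  have /= E1 := congr1 (fun f : semirngMorphism _ _ => f q) e1.
  have /= E2 := congr1 (fun f : semirngMorphism _ _ => f q) e2.
  by apply/eqP; rewrite -pair_eqE /= -/(srng_pb1 _) -/(srng_pb2 _) E1 E2 !eqxx.
Defined.

Definition SRng : pointedLexCategory :=
  @PointedLexCategory SRng_cat SRng_zero SRng_prod SRng_pullback
    SRng_zero_initial.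

Definition Rng : category := full_subcategory (is_ring : SRng -> Prop).

(* Main.v *)
Require Import Defs.
From HB Require Import structures.
From mathcomp Require Import all_boot ssralg.
From mathcomp Require Import boolp.
Set Implicit Arguments.
Unset Strict Implicit.
Unset Printing Implicit Defensive.
Import GRing.Theory.
Local Open Scope ring_scope.

(** In semirings, a pair is jointly strongly epimorphic iff its images generate
    the codomain.  The pullback of [(π1, Δ)] along [g : D --> X] is
    [D × X] with section [d ↦ (d, g d)], and the subsemiring generated by this
    graph and the kernel [0 × X] is [{(d, g d + z)}].  If [X] has additive
    inverses this is everything; conversely, for [g] the identity, if it contains
    [(x, 0)] then [x] has an additive inverse. *)

Lemma srng_hom_eq (R S : SRng) (f g : hom R S) :
  f = g -> (f : semirngMorphism R S) =1 (g : semirngMorphism R S).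
Proof. by move=> ->. Qed.

Section Subsemirng.
Variables (R : semirngType) (S : pred R).
Hypotheses (nmodS : GRing.nmod_closed S) (mulS : mulg_closed S).

(** Inclusions of such subsemirings are the monomorphisms against which joint strong epimorphy is
    tested below. *)
Record subsemirng := Subsemirng { subsemirng_val :> R; _ : S subsemirng_val }.

HB.instance Definition _ := [isSub for subsemirng_val].
HB.instance Definition _ := [Choice of subsemirng by <:].
HB.instance Definition _ :=
  GRing.SubChoice_isSubNmodule.Build _ S subsemirng nmodS.
HB.instance Definition _ :=
  SubChoice_isSubSemigroup.Build _ S subsemirng mulS.

Let valsD := @GRing.valD _ _ subsemirng.
Let vals0 := @GRing.val0 _ _ subsemirng.
Let valsM := @valM _ _ subsemirng.

Fact subsemirng_mulDl : left_distributive (@mul subsemirng) +%R.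
Proof. by move=> x y z; apply/val_inj; rewrite !(valsM, valsD) srng_mulDl. Qed.
Fact subsemirng_mulDr : right_distributive (@mul subsemirng) +%R.
Proof. by move=> x y z; apply/val_inj; rewrite !(valsM, valsD) srng_mulDr. Qed.
Fact subsemirng_mul0r : left_zero (0 : subsemirng) (@mul subsemirng).
Proof. by move=> x; apply/val_inj; rewrite valsM vals0 srng_mul0r. Qed.
Fact subsemirng_mulr0 : right_zero (0 : subsemirng) (@mul subsemirng).
Proof. by move=> x; apply/val_inj; rewrite valsM vals0 srng_mulr0. Qed.
HB.instance Definition _ := Nmodule_Semigroup_isSemirng.Build subsemirng
  subsemirng_mulDl subsemirng_mulDr subsemirng_mul0r subsemirng_mulr0.

Definition subsemirng_incl (x : subsemirng) : R := val x.
Fact subsemirng_incl_nmod_morphism : GRing.nmod_morphism subsemirng_incl.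
Proof. by split=> [|x y]; rewrite /subsemirng_incl ?vals0 ?valsD. Qed.
Fact subsemirng_incl_multiplicative :
  {morph subsemirng_incl : x y / (x * y)%g}.
Proof. by move=> x y; rewrite /subsemirng_incl valsM. Qed.
HB.instance Definition _ := GRing.isNmodMorphism.Build subsemirng R
  subsemirng_incl subsemirng_incl_nmod_morphism.
HB.instance Definition _ := isMultiplicative.Build subsemirng R
  subsemirng_incl subsemirng_incl_multiplicative.

(* The carrier alone does not determine the closure proofs, hence the structure
   and the inclusion are packed while these are fixed. *)
Definition subsemirng_semirng : semirngType := subsemirng.
Definition subsemirng_hom : semirngMorphism subsemirng_semirng R :=
  subsemirng_incl.

Lemma subsemirng_mono : @mono SRng subsemirng_semirng R subsemirng_hom.
Proof.
move=> Z f g /srng_hom_eq fg; apply: semirng_morphism_eq => z.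
exact/val_inj/fg.
Qed.

Variables (Q : semirngType) (u : semirngMorphism Q R).
Hypothesis uS : forall q, S (u q).

Definition corestr (q : Q) : subsemirng := Subsemirng (uS q).
Fact corestr_nmod_morphism : GRing.nmod_morphism corestr.
Proof.
split=> [|x y]; apply/val_inj.
  by rewrite vals0 /= raddf0.
by rewrite valsD /= raddfD.
Qed.
Fact corestr_multiplicative : {morph corestr : x y / (x * y)%g}.
Proof. by move=> x y; apply/val_inj; rewrite valsM /= gmulfM. Qed.
HB.instance Definition _ := GRing.isNmodMorphism.Build Q subsemirng
  corestr corestr_nmod_morphism.
HB.instance Definition _ := isMultiplicative.Build Q subsemirng
  corestr corestr_multiplicative.

Lemma corestr_factors :
  @factors_through SRng R subsemirng_semirng Q subsemirng_hom u.
Proof.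
exists (corestr : semirngMorphism Q subsemirng).
exact: semirng_morphism_eq.
Qed.

End Subsemirng.

(* A mono equalizes its kernel pair, so the two projections of the latter agree. *)
Lemma srng_mono_inj (R S : semirngType) (m : semirngMorphism R S) :
  @mono SRng R S m -> injective m.
Proof.
move=> mono_m x y /eqP mxy.
have /mono_m /srng_hom_eq e := pb_comm (pullbacks (m : @hom SRng R S) m).
exact: (e (SrngPullback (mxy : pb_pred m m (x, y)))).
Qed.

Section BijectiveMorphism.
Variables (R S : semirngType) (m : semirngMorphism R S) (n : S -> R).
Hypotheses (mK : cancel m n) (nK : cancel n m).

Fact inverse_nmod_morphism : GRing.nmod_morphism n.
Proof.
split=> [|x y]; apply: (can_inj mK); first by rewrite nK raddf0.
by rewrite raddfD nK; congr (_ + _); exact: esym (nK _).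
Qed.
Fact inverse_multiplicative : {morph n : x y / (x * y)%g}.
Proof.
move=> x y; apply: (can_inj mK); rewrite gmulfM nK.
by congr (_ * _)%g; exact: esym (nK _).
Qed.

Lemma srng_bij_iso : @iso SRng R S m.
Proof.
pose nA := GRing.isNmodMorphism.Build S R n inverse_nmod_morphism.
pose nM := isMultiplicative.Build S R n inverse_multiplicative.
pose n' : semirngMorphism S R := HB.pack n nA nM.
exists n'; split; apply: semirng_morphism_eq => ?; [exact: mK|exact: nK].
Qed.

End BijectiveMorphism.

(** From left to right, the inclusion of [S] is a mono through which [u] and [v] factor, so it is
    invertible and every [x] lies in [S]. Conversely, the image of a mono [m] through which both
    factor is a subsemiring containing their images, so [m] is surjective as well as injective. *)
Lemma srng_jointly_strongly_epiP (R Q T : semirngType)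
    (u : semirngMorphism Q R) (v : semirngMorphism T R) :
  @jointly_strongly_epi SRng R Q T u v <->
  (forall S : pred R, GRing.nmod_closed S -> mulg_closed S ->
     (forall q, S (u q)) -> (forall t, S (v t)) -> forall x, S x).
Proof.
split=> [uv S nmodS mulS uS vS x|gen M m mono_m [u' mu'] [v' mv']].
  have [n [_ /srng_hom_eq nK]] := uv _ _ (@subsemirng_mono R S nmodS mulS)
    (corestr_factors nmodS mulS uS) (corestr_factors nmodS mulS vS).
  rewrite -[x]nK; exact: valP.
have /srng_mono_inj m_inj := mono_m.
have m_surj : forall x, `[< exists y, (m : semirngMorphism M R) y = x >].
  apply: gen.
  - split; first by apply/asboolP; exists 0; rewrite raddf0.
    move=> _ _ /asboolP[x <-] /asboolP[y <-].
    by apply/asboolP; exists (x + y); rewrite raddfD.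
  - move=> _ _ /asboolP[x <-] /asboolP[y <-].
    by apply/asboolP; exists (x * y)%g; rewrite gmulfM.
  - by move=> q; apply/asboolP; exists ((u' : semirngMorphism _ _) q); rewrite -mu'.
  - by move=> t; apply/asboolP; exists ((v' : semirngMorphism _ _) t); rewrite -mv'.
have /choice[n nK] x := asboolW (m_surj x).
by apply: (@srng_bij_iso M R m n) => // x; apply: m_inj; rewrite nK.
Qed.

(** With [x' + x = 0] for [x = g d], the decomposition [(d, (x, y)) = (d, (x, x)) + (0, (0, x' +
    y))] writes any element of the pullback as a value of the section plus an element of the
    kernel. *)
Lemma ring_stably_strong (X : SRng) :
  is_ring X -> stably_strong (diagonal_point X).
Proof.
move=> ringX D g E h; apply/srng_jointly_strongly_epiP => S [S0 SD] _ kerS secS.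
case=> -[d [x y]] /= gdx.
have [x' xx'] := ringX x.
have kP : pb_pred (g : semirngMorphism D X) (@fst X X) (0, (0, x' + y)).
  by rewrite /pb_pred /= raddf0.
(* Since [h 0 = 0], pairing the kernel element with [0] in [E] puts it in the image of [pb2],
   whatever [h] is. *)
have qP : pb_pred (h : semirngMorphism E D)
    (@srng_pb1 _ _ _ (g : semirngMorphism D X) (@fst X X)) (0, SrngPullback kP).
  by rewrite /pb_pred /= raddf0.
suff -> : SrngPullback gdx =
    pt_sect (pullback_point g (diagonal_point X)) d + SrngPullback kP.
  by apply: SD; [apply: secS | apply: (kerS (SrngPullback qP))].
have gd : (g : semirngMorphism D X) d = x by apply/eqP.
apply/val_inj; rewrite GRing.valD /= /srng_pair gd.
congr (_, (_, _)); rewrite /= ?addr0 //.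
by rewrite addrA xx' add0r.
Qed.

Lemma stably_strong_ring (X : SRng) :
  stably_strong (diagonal_point X) -> is_ring X.
Proof.
move=> strongX x.
(* Strength is tested along the zero morphism from the zero object, so the first leg becomes the
   kernel inclusion. *)
have /srng_jointly_strongly_epiP gen :=
  strongX X (idm X) SRng_zero (@srng_zero unit X : semirngMorphism unit X).
pose S (p : srng_pullback (idfun : semirngMorphism X X) (@fst X X)) :=
  `[< exists z, (val p).2.2 = (val p).1 + z >].
have xP : pb_pred (idfun : semirngMorphism X X) (@fst X X) (x, (x, 0)).
  exact: eqxx.
suff /asboolP[z /= xz] : S (SrngPullback xP) by exists z.
apply: gen.
- split; first by apply/asboolP; exists 0; rewrite GRing.val0 /= addr0.
  move=> p q /asboolP[z zp] /asboolP[w wq]; apply/asboolP; exists (z + w).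
  by rewrite GRing.valD /= zp wq addrACA.
- move=> p q /asboolP[z zp] /asboolP[w wq]; apply/asboolP.
  (* Expand [(a + z) * (b + w)] as [a * b + (a * w + z * (b + w))], where [a] and [b] are the first
     components of [p] and [q]. *)
  exists (((val p).1 * w)%g + (z * ((val q).1 + w)%R)%g).
  by rewrite valM /= zp wq srng_mulDl srng_mulDr addrA.
(* Kernel elements have [d = 0], so [b] itself is the required difference. *)
- case=> -[[] [[d [a b]] /= ab]] d0; apply/asboolP; exists b => /=.
  have <- : 0 = d by exact: eqP d0.
  by rewrite add0r.
- by move=> t; apply/asboolP; exists 0; rewrite /= addr0.
Qed.

Theorem theorem4p3 :
  full_subcategory (@strongly_unital SRng) = Rng /\
  forall X : SRng, is_ring X <-> stably_strong (diagonal_point X).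
Proof.
have ringP (X : SRng) : is_ring X <-> stably_strong (diagonal_point X).
  by split; [apply: ring_stably_strong | apply: stably_strong_ring].
(* Equivalent predicates are equal by extensionality, which makes the two categories equal on the
   nose. *)
split=> //; rewrite /Rng; congr full_subcategory.
by apply/funext => X; apply/propext; rewrite ringP.
Qed.
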